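(* Let $G$ be a (discrete) group that satisfies the analytic zero-divisor conjecture and commensurates a non-trivial amenable subgroup. If $G$ has cohomological dimension $n$ (over $\mathbb{Z}$) and is of type $FP_{n-1}$, then $G$ is of type $FP$.
   Context: All groups are discrete. A group $G$ commensurates a subgroup $H$ if for every $g\in G$ the intersection $H^g\cap H$ has finite index in both $H$ and $H^g$, where $H^g$ denotes the conjugate of $H$ by $g$. Cohomological dimension $\mathrm{cd}(G)$ is over $\mathbb{Z}$: the length of the shortest projective $\mathbb{Z}[G]$-resolution of the trivial module $\mathbb{Z}$ (infinite if no finite length projective resolution exists). $G$ is of type $FP_n$ if there is a projective $\mathbb{Z}[G]$-resolution $P_*$ of the trivial module $\mathbb{Z}$ with $P_d$ finitely generated for all $0\le d\le n$. $G$ is of type $FP$ if there is a finite length projective $\mathbb{Z}[G]$-resolution $P_*$ of $\mathbb{Z}$ with every $P_d$ finitely generated. A group $G$ satisfies the analytic zero-divisor conjecture if for all $\alpha\in\mathbb{C}[G]\setminus\{0\}$ and $\beta\in l^2(G)\setminus\{0\}$ one has $\alpha\beta\neq 0$, where $l^2(G)$ is the space of formal sums $\sum_{g\in G}a_g g$ with $a_g\in\mathbb{C}$ and $\sum_{g}|a_g|^2<\infty$, and the product of $\alpha=\sum a_g g$ and $\beta=\sum b_h h$ is $\sum_{g}\big(\sum_{h}a_{gh^{-1}}b_h\big)g$. A group is amenable if for every continuous action of it on a compact Hausdorff space there is an invariant probability measure on that space. *)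

(* Defs.v *)
From HB Require Import structures.
From mathcomp Require Import all_boot all_order all_algebra.
From mathcomp Require Import finmap complex.
From mathcomp Require Import all_classical all_reals all_analysis.

Set Implicit Arguments.
Unset Strict Implicit.
Unset Printing Implicit Defensive.

Import Order.TTheory GRing.Theory Num.Theory.

Local Open Scope classical_set_scope.
Local Open Scope ring_scope.

Section FiniteSums.
Variables (I : choiceType) (V : nmodType).

Lemma fsumE (S : set I) (F : I -> V) :
    finite_set S -> (forall i, ~ S i -> F i = 0) ->
  \sum_(i \in [set: I]) F i = \sum_(i <- fset_set S) F i.
Proof.
move=> finS F0; rewrite -fsbig_finite//; apply/esym/fsbig_widen => //.
by move=> i [_ /F0].
Qed.

Lemma fsum_delta (j : I) (F : I -> V) :
  (forall i, i != j -> F i = 0) -> \sum_(i \in [set: I]) F i = F j.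
Proof.
move=> F0; rewrite -(fsbig_widen [set j])// ?fsbig_set1// => i [_ ij].
by apply: F0; apply/eqP.
Qed.

End FiniteSums.

Definition finsupp (G : Type) (K : nmodType) (a : G -> K) : set G :=
  [set g | a g != 0].

Lemma notin_finsupp (G : Type) (K : nmodType) (a : G -> K) g :
  ~ finsupp a g -> a g = 0.
Proof. by move=> /negP; rewrite negbK => /eqP. Qed.

(* The inner sum is a [fsbigop] sum, which is 0 by convention when infinitely
   many summands are nonzero; here one factor always has finite support. *)
Definition convolution (K : nzRingType) (G : groupType) (a b : G -> K) : G -> K :=
  fun g => \sum_(h \in [set: G]) a (g * h^-1)%g * b h.

Section Convolution.
Variables (K : nzRingType) (G : groupType).
Implicit Types a b c : G -> K.

Local Notation delta1 := (fun g : G => (g == 1%g)%:R : K).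

Lemma bijective_mulgr (h : G) : bijective (fun k : G => (k * h)%g).
Proof. by exists (fun k => (k * h^-1)%g) => k; rewrite (mulgK, mulgVK). Qed.

Lemma convolutionE a b g (S : set G) : finite_set S ->
    (forall h, ~ S h -> b h = 0) ->
  convolution a b g = \sum_(h <- fset_set S) a (g * h^-1)%g * b h.
Proof. by move=> finS b0; apply: fsumE => // h nSh; rewrite (b0 h nSh) mulr0. Qed.

Lemma finsupp_convolution a b : finsupp (convolution a b) `<=`
  [set (x * y)%g | x in finsupp a & y in finsupp b].
Proof.
move=> g; apply: contraPP => nS; apply/negP; rewrite negbK; apply/eqP.
rewrite /convolution fsbig1// => h _.
have [->|ah] := eqVneq (a (g * h^-1)%g) 0; first by rewrite mul0r.
have [->|bh] := eqVneq (b h) 0; first by rewrite mulr0.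
by case: nS; exists (g * h^-1)%g => //; exists h => //; rewrite mulgVK.
Qed.

Lemma finite_finsupp_convolution a b : finite_set (finsupp a) ->
  finite_set (finsupp b) -> finite_set (finsupp (convolution a b)).
Proof.
by move=> fa fb; apply: sub_finite_set (@finsupp_convolution a b) _;
  apply: finite_image2.
Qed.

Lemma convolutionA a b c : finite_set (finsupp a) -> finite_set (finsupp b) ->
  finite_set (finsupp c) ->
  convolution a (convolution b c) = convolution (convolution a b) c.
Proof.
move=> fa fb fc; apply/funext => g.
rewrite [RHS](convolutionE _ _ fc (@notin_finsupp _ _ c)).
pose D := [set (x * y)%g | x in finsupp b & y in finsupp c].
have fD : finite_set D by exact: finite_image2.
rewrite (@convolutionE _ _ _ D)//; last first.
  move=> h nDh; apply: notin_finsupp.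
  exact: contra_not (@finsupp_convolution b c h) nDh.
under eq_bigr => l _ do rewrite (convolutionE _ _ fc (@notin_finsupp _ _ c)) mulr_sumr.
rewrite exchange_big/=; apply: eq_big_seq => h hc.
have ch : finsupp c h by rewrite in_fset_set// inE in hc.
rewrite (convolutionE _ _ fb (@notin_finsupp _ _ b)) mulr_suml.
rewrite -(@fsumE _ _ D (fun l => a (g * l^-1)%g * (b (l * h^-1)%g * c h)))//;
    last first.
  move=> l nDl; rewrite [b _](_ : _ = 0) ?(mul0r, mulr0)//.
  apply: notin_finsupp => bl; apply: nDl.
  by exists (l * h^-1)%g => //; exists h => //; rewrite mulgVK.
rewrite (reindex_fsbigT _ _ (bijective_mulgr h)).
rewrite (@fsumE _ _ (finsupp b))//; last first.
  by move=> k nbk; rewrite mulgK (notin_finsupp nbk) mul0r mulr0.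
by apply: eq_bigr => k _; rewrite mulgK invgM !mulgA mulrA.
Qed.

Lemma convolution1l b : convolution delta1 b = b.
Proof.
apply/funext => g; rewrite /convolution (fsum_delta (j := g)).
  by rewrite mulgV eqxx mul1r.
move=> h hg; case: eqP => [e|]; last by rewrite mul0r.
by move: hg; rewrite -[g](mulgVK h) e mul1g eqxx.
Qed.

Lemma convolution1r a : convolution a delta1 = a.
Proof.
apply/funext => g; rewrite /convolution (fsum_delta (j := 1%g)).
  by rewrite eqxx invg1 mulg1 mulr1.
by move=> h /negPf ->; rewrite mulr0.
Qed.

Lemma convolutionDl a b c : finite_set (finsupp c) ->
  convolution (a + b) c = convolution a c + convolution b c.
Proof.
move=> fc; apply/funext => g; have c0 := @notin_finsupp _ _ c.
rewrite [RHS](_ : _ = convolution a c g + convolution b c g)//.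
rewrite !(convolutionE _ _ fc c0).
by rewrite -big_split/=; apply: eq_bigr => h _; rewrite mulrDl.
Qed.

Lemma convolutionDr a b c : finite_set (finsupp b) -> finite_set (finsupp c) ->
  convolution a (b + c) = convolution a b + convolution a c.
Proof.
move=> fb fc; apply/funext => g.
rewrite [RHS](_ : _ = convolution a b g + convolution a c g)//.
have fS : finite_set (finsupp b `|` finsupp c) by rewrite finite_setU.
have b0 h : ~ (finsupp b `|` finsupp c) h -> b h = 0.
  by move=> nS; apply: notin_finsupp => ?; apply: nS; left.
have c0 h : ~ (finsupp b `|` finsupp c) h -> c h = 0.
  by move=> nS; apply: notin_finsupp => ?; apply: nS; right.
rewrite (convolutionE _ _ fS b0) (convolutionE _ _ fS c0).
rewrite (convolutionE _ _ fS); last first.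
  by move=> h nS; rewrite [LHS](_ : _ = b h + c h)// b0// c0// addr0.
by rewrite -big_split/=; apply: eq_bigr => h _; rewrite mulrDr.
Qed.

Lemma finsupp_delta1 : finite_set (finsupp delta1).
Proof.
apply: (sub_finite_set _ (finite_set1 1%g)) => g; rewrite /finsupp/=.
by case: (eqVneq g 1%g) => // _; rewrite eqxx.
Qed.

End Convolution.

Definition finsupp_pred (K : zmodType) (G : Type) : {pred G -> K} :=
  fun a => `[< finite_set (finsupp a) >].
Arguments finsupp_pred : clear implicits.

Lemma finsupp_zmod_closed (K : zmodType) (G : Type) :
  zmod_closed (finsupp_pred K G).
Proof.
split.
  apply/asboolP/(sub_finite_set _ (finite_set0 G)) => g.
  by rewrite /finsupp/= eqxx.
move=> a b /asboolP fa /asboolP fb; apply/asboolP.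
apply: (@sub_finite_set _ _ (finsupp a `|` finsupp b)); last first.
  by rewrite finite_setU.
move=> g; apply: contraPP => nS; apply/negP; rewrite negbK; apply/eqP.
have -> : (a - b) g = a g - b g by [].
have a0 : a g = 0 by apply: notin_finsupp => ?; apply: nS; left.
have b0 : b g = 0 by apply: notin_finsupp => ?; apply: nS; right.
by rewrite a0 b0 subr0.
Qed.

HB.instance Definition _ (K : zmodType) (G : Type) :=
  GRing.isZmodClosed.Build (G -> K) (finsupp_pred K G)
    (@finsupp_zmod_closed K G).

Record groupRing (K : nzRingType) (G : groupType) := GroupRing {
  group_coef :> G -> K;
  _ : group_coef \in finsupp_pred K G
}.

HB.instance Definition _ (K : nzRingType) (G : groupType) :=
  [isSub for @group_coef K G].
HB.instance Definition _ (K : nzRingType) (G : groupType) :=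
  [Choice of groupRing K G by <:].
HB.instance Definition _ (K : nzRingType) (G : groupType) :=
  [SubChoice_isSubZmodule of groupRing K G by <:].

Section GroupRing.
Variables (K : nzRingType) (G : groupType).
Implicit Types a b c : groupRing K G.

Lemma groupRingP a : finite_set (finsupp a).
Proof. by case: a => a /= /asboolP. Qed.

Lemma groupRing1_subproof :
  (fun g : G => (g == 1%g)%:R : K) \in finsupp_pred K G.
Proof. exact/asboolP/finsupp_delta1. Qed.
Definition groupRing1 := GroupRing groupRing1_subproof.

Lemma groupRingM_subproof a b : convolution a b \in finsupp_pred K G.
Proof.
by apply/asboolP/finite_finsupp_convolution; exact: groupRingP.
Qed.
Definition groupRingM a b := GroupRing (groupRingM_subproof a b).

Let mulA : associative groupRingM.
Proof.
by move=> a b c; apply/val_inj; apply: convolutionA; exact: groupRingP.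
Qed.

Let mul1 : left_id groupRing1 groupRingM.
Proof. by move=> a; apply/val_inj; exact: convolution1l. Qed.

Let mulr1 : right_id groupRing1 groupRingM.
Proof. by move=> a; apply/val_inj; exact: convolution1r. Qed.

Let mulDl : left_distributive groupRingM +%R.
Proof.
by move=> a b c; apply/val_inj; apply: convolutionDl; exact: groupRingP.
Qed.

Let mulDr : right_distributive groupRingM +%R.
Proof.
by move=> a b c; apply/val_inj; apply: convolutionDr; exact: groupRingP.
Qed.

Let oner_neq0 : groupRing1 != 0.
Proof.
apply/eqP => /(congr1 (fun a : groupRing K G => a 1%g)) /= /eqP.
by rewrite eqxx (negPf (@oner_neq0 K)).
Qed.

HB.instance Definition _ := GRing.Zmodule_isNzRing.Build (groupRing K G)
  mulA mul1 mulr1 mulDl mulDr oner_neq0.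

Definition coef_sum a : K := \sum_(g \in [set: G]) a g.

Lemma coef_sumE a (S : set G) : finite_set S -> (forall h, ~ S h -> a h = 0) ->
  coef_sum a = \sum_(g <- fset_set S) a g.
Proof. exact: fsumE. Qed.

Lemma coef_sum1 : coef_sum 1 = 1.
Proof.
by rewrite /coef_sum (fsum_delta (j := 1%g)) /= ?eqxx// => g /negPf ->.
Qed.

Lemma coef_sumD a b : coef_sum (a + b) = coef_sum a + coef_sum b.
Proof.
pose S := finsupp a `|` finsupp b.
have fS : finite_set S by rewrite finite_setU; split; exact: groupRingP.
have a0 h : ~ S h -> a h = 0.
  by move=> nS; apply: notin_finsupp => ?; apply: nS; left.
have b0 h : ~ S h -> b h = 0.
  by move=> nS; apply: notin_finsupp => ?; apply: nS; right.
rewrite !(@coef_sumE _ S)// -?big_split// => h nS.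
by have -> : (a + b) h = a h + b h by []; rewrite a0// b0// addr0.
Qed.

Lemma coef_sumM a b : coef_sum (a * b) = coef_sum a * coef_sum b.
Proof.
pose D := [set (x * y)%g | x in finsupp a & y in finsupp b].
have fD : finite_set D by apply: finite_image2; exact: groupRingP.
have a0 := @notin_finsupp _ _ a; have b0 := @notin_finsupp _ _ b.
have fa := groupRingP a; have fb := groupRingP b.
rewrite (@coef_sumE (a * b) D)//; last first.
  move=> h nDh; apply: notin_finsupp.
  exact: contra_not (@finsupp_convolution _ _ a b h) nDh.
under eq_bigr => g _ do rewrite [(a * b) g](convolutionE _ _ fb b0).
rewrite exchange_big/= (coef_sumE fb b0) mulr_sumr.
apply: eq_big_seq => h hb.
have bh : finsupp b h by rewrite in_fset_set// inE in hb.
rewrite -(@fsumE _ _ D (fun g => a (g * h^-1)%g * b h))//; last first.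
  move=> g nDg; rewrite [a _](_ : _ = 0) ?mul0r//.
  apply: notin_finsupp => ag; apply: nDg.
  by exists (g * h^-1)%g => //; exists h => //; rewrite mulgVK.
rewrite (reindex_fsbigT _ _ (bijective_mulgr h)) (coef_sumE fa a0) mulr_suml.
rewrite (@fsumE _ _ (finsupp a))//; last first.
  by move=> k nak; rewrite mulgK (a0 k nak) mul0r.
by apply: eq_bigr => k _; rewrite mulgK.
Qed.

End GroupRing.

Definition trivial_module (G : groupType) : Type := int.

HB.instance Definition _ (G : groupType) :=
  GRing.Zmodule.copy (trivial_module G) int.

Section TrivialModule.
Variable G : groupType.
Local Notation ZG := (groupRing int G).
Local Notation Z := (trivial_module G).

(* g acts as the identity, so an element of Z[G] acts through the sum of its
   coefficients. *)
Definition trivial_scale (a : ZG) (z : Z) : Z := coef_sum a * (z : int).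

Let scaleA (a b : ZG) (z : Z) :
  trivial_scale a (trivial_scale b z) = trivial_scale (a * b) z.
Proof. by rewrite /trivial_scale coef_sumM mulrA. Qed.

Let scale1 : left_id 1 trivial_scale.
Proof. by move=> z; rewrite /trivial_scale coef_sum1 mul1r. Qed.

Let scaleDr : right_distributive trivial_scale +%R.
Proof. by move=> a y z; rewrite /trivial_scale mulrDr. Qed.

Let scaleDl (z : Z) : {morph trivial_scale^~ z : a b / a + b}.
Proof. by move=> a b; rewrite /trivial_scale coef_sumD mulrDl. Qed.

HB.instance Definition _ := GRing.Zmodule_isLmodule.Build ZG Z
  scaleA scale1 scaleDr scaleDl.

End TrivialModule.

Definition projective (A : nzRingType) (P : lmodType A) : Prop :=
  forall (M N : lmodType A) (f : {linear M -> N}) (g : {linear P -> N}),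
    (forall y, exists x, f x = y) ->
    exists h : {linear P -> M}, forall x, f (h x) = g x.

Definition finitely_generated (A : nzRingType) (M : lmodType A) : Prop :=
  exists (k : nat) (v : 'I_k -> M),
    forall x, exists c : 'I_k -> A, x = \sum_(i < k) c i *: v i.

Record projective_resolution (A : nzRingType) (M : lmodType A) :=
  ProjectiveResolution {
  chain :> nat -> lmodType A;
  boundary : forall d, {linear chain d.+1 -> chain d};
  augmentation : {linear chain 0 -> M};
  chain_projective : forall d, projective (chain d);
  augmentation_surjective : forall m, exists p, augmentation p = m;
  exact_at_0 : forall p, augmentation p = 0 <-> exists q, boundary 0 q = p;
  exact_at_S : forall d p,
    boundary d p = 0 <-> exists q, boundary d.+1 q = p
}.

Definition length_at_most (A : nzRingType) (M : lmodType A)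
    (P : projective_resolution M) (n : nat) : Prop :=
  forall d, (n < d)%N -> forall x : P d, x = 0.

Section Finiteness.
Variable G : groupType.
Local Notation resolution :=
  (@projective_resolution (groupRing int G) (trivial_module G)).

Definition cohomological_dimension_at_most (n : nat) : Prop :=
  exists P : resolution, length_at_most P n.

Definition cohomological_dimension (n : nat) : Prop :=
  cohomological_dimension_at_most n /\
  forall m, cohomological_dimension_at_most m -> (n <= m)%N.

(* The index is an integer so that n - 1 is not truncated when n = 0;
   the condition is then only that a resolution exists. *)
Definition type_FPn (n : int) : Prop :=
  exists P : resolution,
    forall d : nat, d%:Z <= n -> finitely_generated (P d).

Definition type_FP : Prop :=
  exists P : resolution, (exists n, length_at_most P n) /\
    forall d, finitely_generated (P d).

End Finiteness.

Definition square_summable (R : realType) (G : choiceType) (b : G -> R[i]) : Prop :=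
  (\esum_(g in [set: G]) (complex.Re (b g) ^+ 2 + complex.Im (b g) ^+ 2)%:E
    < +oo)%E.

Definition analytic_zero_divisor_conjecture (R : realType) (G : groupType) : Prop :=
  forall (a : groupRing R[i] G) (b : G -> R[i]),
    a != 0 -> square_summable b -> b <> 0 -> convolution a b <> 0.

Definition conjugate (G : groupType) (H : set G) (g : G) : set G :=
  [set (x ^ g)%g | x in H].

(* meant for subgroups K, H of G with K contained in H *)
Definition finite_index (G : groupType) (K H : set G) : Prop :=
  finite_set [set [set (h * k)%g | k in K] | h in H].

Definition commensurates (G : groupType) (H : set G) : Prop :=
  forall g : G, finite_index (conjugate H g `&` H) H /\
                finite_index (conjugate H g `&` H) (conjugate H g).

(* G is discrete: an action is continuous as soon as each element acts by a
   continuous map. *)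
Record continuous_action (G : groupType) (X : topologicalType) :=
  ContinuousAction {
  act :> G -> X -> X;
  act1 : forall x, act 1%g x = x;
  actM : forall g h x, act (g * h)%g x = act g (act h x);
  act_continuous : forall g, continuous (act g)
}.

(* Spaces are pointed, hence nonempty; measures live on the Borel sets. *)
Definition amenable (R : realType) (G : groupType) : Prop :=
  forall (X : ptopologicalType) (act : continuous_action G X),
    compact [set: X] -> hausdorff_space X ->
    exists mu : probability (g_sigma_algebraType (@open X)) R,
      forall (g : G) (A : set (g_sigma_algebraType (@open X))),
        measurable A -> mu (act g @^-1` A) = mu A.

Definition subgroup_type (G : groupType) (H : groupClosed G) : Type :=
  {x : G | x \in H}.

HB.instance Definition _ (G : groupType) (H : groupClosed G) :=
  SubChoice.on (subgroup_type H).

Lemma subgroup_group_closed (G : groupType) (H : groupClosed G) :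
  group_closed (fun x => x \in H).
Proof. by split; [exact: gpred1 | move=> x y xH yH; exact: gpredF]. Qed.

HB.instance Definition _ (G : groupType) (H : groupClosed G) :=
  SubChoice_isSubGroup.Build G (fun x => x \in H) (subgroup_type H)
    (subgroup_group_closed H).

(* Main.v *)
From HB Require Import structures.
From mathcomp Require Import all_boot all_order all_algebra all_fingroup.
From mathcomp Require Import finmap complex.
From mathcomp Require Import all_classical all_reals all_analysis.
Require Import Defs.

(** Write R = Z[G] and let S be the set of nonzero elements of Z[H], where H is
    the commensurated amenable subgroup.  The idea is to invert S.

    (1) R has no zero divisors, because finitely supported functions are square
    summable ([analytic_zero_divisor_domain]).

    (2) S satisfies the left Ore condition in R: for r in R and s in S there
    are s' in S and r' in R with s' r = r' s ([subgroup_denominators_ore]).  By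
    commensuration, all left translates by H of the terms of r, and all their
    right translates by H, lie in one finite union of right cosets H y_1, ...,
    H y_q.  Hence r, y_1 s, ..., y_q s are q + 1 elements of the free left
    Z[H]-module with basis y_1, ..., y_q.  They are linearly dependent over
    Z[H], because H is amenable ([strong_rank_condition]); by (1) the
    coefficient of r in the dependence is not 0.

    The rank condition for an amenable H says that p vectors in Z[H]^q are
    dependent as soon as q < p.  If they were independent, the expansion of a
    determinant would match every finite subset of H x {1..p} injectively into
    H x {1..q}, moving the H-component only by right multiplication by
    elements of a fixed finite set.  By compactness there is a matching of all
    of H x {1..p}, and the matchings form a compact space on which H acts.  An
    invariant probability measure on that space gives a random matching whose
    law is invariant; the expected number of points sent out of each element
    of H is p, the expected number received is at most q, and by invariance
    the two are equal, so p <= q ([amenable_matching_bound]).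

    (3) H has an element x other than 1, and x - 1 in S kills the trivial
    module.  Hence S^-1 Z = 0, so that every projective resolution of Z becomes
    contractible after localization at S.

    (4) Let Q be a resolution with Q_d finitely generated for d < n, and let K
    be the image of Q_n -> Q_(n-1).  Comparing Q with a resolution of length n
    shows that K is projective ([syzygy_projective]).  The contraction at level
    n - 1 sends the finitely many generators of Q_(n-1) to S^-1 K, so finitely
    many elements of K generate S^-1 K.  A projective module embeds in a free
    module; these elements involve only finitely many coordinates, so all of K
    does, and therefore K is finitely generated
    ([syzygy_finitely_generated]).  The complex
    0 -> K -> Q_(n-1) -> ... -> Q_0 is then the resolution sought
    ([syzygy_FP]).

    Localized modules are not constructed: a homomorphism from P to S^-1 N is
    represented by its graph in P x N, a submodule whose first projection
    meets every cyclic submodule R p in some s p with s in S. *)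

Set Implicit Arguments.
Unset Strict Implicit.
Unset Printing Implicit Defensive.

Import Order.TTheory GRing.Theory Num.Theory.

Local Open Scope classical_set_scope.
Local Open Scope ring_scope.

(** * Free modules and dual bases *)

Section FreeModule.
Variables (A : nzRingType) (X : choiceType).

Let finsupp_scaler_closed : GRing.scaler_closed (finsupp_pred A^o X).
Proof.
move=> a f /asboolP ff; apply/asboolP; apply: sub_finite_set ff => x.
rewrite /finsupp/=; apply: contra_neq => fx0.
have -> : (a *: f) x = a * f x by [].
by rewrite fx0 mulr0.
Qed.

HB.instance Definition _ :=
  GRing.isScaleClosed.Build A (X -> A^o) (finsupp_pred A^o X)
    finsupp_scaler_closed.

(** Coefficients are in A^o, that is, in A as a left module over itself. *)
Record free_module := FreeModule {
  free_coord :> X -> A^o;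
  _ : free_coord \in finsupp_pred A^o X
}.

HB.instance Definition _ := [isSub for free_coord].
HB.instance Definition _ := [Choice of free_module by <:].
HB.instance Definition _ := [SubChoice_isSubLmodule of free_module by <:].

Lemma free_moduleP (f : free_module) : finite_set (finsupp f).
Proof. by case: f => f /= /asboolP. Qed.

Lemma free_coordD (f g : free_module) x : (f + g) x = f x + g x.
Proof. by []. Qed.

Lemma free_coordZ a (f : free_module) x : (a *: f) x = a * f x.
Proof. by []. Qed.

Let basis_subproof (x : X) :
  (fun y => (y == x)%:R : A^o) \in finsupp_pred A^o X.
Proof.
apply/asboolP; apply: (sub_finite_set _ (finite_set1 x)) => y.
by rewrite /finsupp/=; case: (eqVneq y x) => // _; rewrite eqxx.
Qed.
Definition basis_vector x := FreeModule (basis_subproof x).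

Section Eval.
Variables (M : lmodType A) (v : X -> M).

Definition free_eval (f : free_module) : M :=
  \sum_(x \in [set: X]) (f x : A) *: v x.

Lemma free_evalE (S : set X) (f : free_module) : finite_set S ->
    (forall x, ~ S x -> f x = 0) ->
  free_eval f = \sum_(x <- fset_set S) (f x : A) *: v x.
Proof. by move=> fS f0; apply: fsumE => // x /f0 ->; rewrite scale0r. Qed.

Lemma free_eval_supp (r : free_module) :
  free_eval r = \sum_(x <- fset_set (finsupp r)) (r x : A) *: v x.
Proof.
exact: free_evalE (free_moduleP r) (@notin_finsupp _ _ (free_coord r)).
Qed.

Let free_eval_linear : linear free_eval.
Proof.
move=> a f g; pose S := finsupp f `|` finsupp g.
have fS : finite_set S by rewrite finite_setU; split; exact: free_moduleP.
have f0 h : ~ S h -> f h = 0.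
  by move=> nS; apply: notin_finsupp => ?; apply: nS; left.
have g0 h : ~ S h -> g h = 0.
  by move=> nS; apply: notin_finsupp => ?; apply: nS; right.
have fg0 h : ~ S h -> (a *: f + g) h = 0.
  by move=> nS; rewrite free_coordD free_coordZ f0// g0// mulr0 addr0.
rewrite (free_evalE fS fg0) (free_evalE fS f0) (free_evalE fS g0).
rewrite scaler_sumr -big_split; apply: eq_bigr => x _.
by rewrite free_coordD free_coordZ scalerDl scalerA.
Qed.

HB.instance Definition _ :=
  GRing.isLinear.Build A free_module M _ free_eval free_eval_linear.

Lemma free_eval_basis x : free_eval (basis_vector x) = v x.
Proof.
rewrite /free_eval (fsum_delta (j := x)) /= ?eqxx ?scale1r// => y /negPf ->.
by rewrite scale0r.
Qed.

End Eval.
End FreeModule.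

Section FreeEvalTheory.
Variables (A : nzRingType) (X : choiceType) (M : lmodType A).
Implicit Type r : free_module A X.

Lemma linear_free_eval (N : lmodType A) (f : {linear M -> N}) (v : X -> M) r :
  f (free_eval v r) = free_eval (f \o v) r.
Proof.
rewrite !free_eval_supp linear_sum; apply: eq_bigr => x _.
by rewrite linearZ.
Qed.

Lemma free_evalD (u v : X -> M) r :
  free_eval (fun x => u x + v x) r = free_eval u r + free_eval v r.
Proof.
rewrite !free_eval_supp -big_split; apply: eq_bigr => x _.
exact: scalerDr.
Qed.

Lemma free_module_of_fset (Y : {fset X}) (c : X -> A) :
  exists r : free_module A X, forall x, r x = if x \in Y then c x else 0.
Proof.
have fin : (fun x => if x \in Y then c x else 0 : A^o) \in finsupp_pred A^o X.
  apply/asboolP; apply: (sub_finite_set _ (finite_fset Y)) => x.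
  by rewrite /finsupp/=; case: ifP => //; rewrite eqxx.
by exists (FreeModule fin).
Qed.

End FreeEvalTheory.

(** The dual basis lemma: a section of the surjection from the free module on
    the set P itself. It is the only way in which projectivity gives access to
    coordinates. *)
Lemma dual_basis (A : nzRingType) (P : lmodType A) : projective P ->
  exists lam : {linear P -> free_module A P},
    forall p, free_eval id (lam p) = p.
Proof.
move=> projP.
have [x|lam lamK] := projP _ _
    (free_eval id : {linear free_module A P -> P}) idfun.
  by exists (basis_vector A x); rewrite /= free_eval_basis.
by exists lam => p; exact: lamK.
Qed.

(** * Images of linear maps as modules *)

Section ImageModule.
Variables (A : nzRingType) (U V : lmodType A) (f : {linear U -> V}).

Definition image_pred : {pred V} := fun y => `[< exists x, f x = y >].

Let image_submod_closed : submod_closed image_pred.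
Proof.
split; first by apply/asboolP; exists 0; rewrite linear0.
move=> a u v /asboolP[x <-] /asboolP[y <-].
by apply/asboolP; exists (a *: x + y); rewrite linearP.
Qed.

HB.instance Definition _ :=
  GRing.isSubmodClosed.Build A V image_pred image_submod_closed.

Record image_module := ImageModule {
  image_val : V;
  image_valP : image_val \in image_pred
}.

HB.instance Definition _ := [isSub for image_val].
HB.instance Definition _ := [Choice of image_module by <:].
HB.instance Definition _ := [SubChoice_isSubLmodule of image_module by <:].

Let image_val_linear : linear image_val.
Proof. by []. Qed.
HB.instance Definition _ :=
  GRing.isLinear.Build A image_module V _ image_val image_val_linear.

Lemma image_val_inj : injective image_val.
Proof. exact: val_inj. Qed.

Lemma image_moduleP (y : image_module) : exists x, f x = image_val y.
Proof. by case: y => y /= /asboolP. Qed.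

Let corestrict_subproof x : f x \in image_pred.
Proof. by apply/asboolP; exists x. Qed.
Definition corestrict x := ImageModule (corestrict_subproof x).

Let corestrict_linear : linear corestrict.
Proof. by move=> a x y; apply: val_inj; rewrite /= linearP. Qed.
HB.instance Definition _ :=
  GRing.isLinear.Build A U image_module _ corestrict corestrict_linear.

Lemma corestrict_surj y : exists x, corestrict x = y.
Proof.
by have [x fx] := image_moduleP y; exists x; apply: image_val_inj.
Qed.
End ImageModule.

(** * Ore localization by graphs *)

Definition domain (A : nzRingType) : Prop :=
  forall a b : A, a * b = 0 -> a = 0 \/ b = 0.

(** In a ring without zero divisors, these are the conditions under which left
    fractions with denominators in S can be formed. *)
Record left_denominator_set (A : nzRingType) (S : A -> Prop) : Prop :=
  LeftDenominatorSet {
  denominator1 : S 1;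
  denominatorM : forall s t, S s -> S t -> S (s * t);
  denominator_neq0 : forall s, S s -> s != 0;
  denominator_ore : forall r s, S s -> exists r' s', S s' /\ s' * r = r' * s
}.

Section Localization.
Variables (A : nzRingType) (S : A -> Prop).
Hypotheses (domA : domain A) (denS : left_denominator_set S).

(** Finitely many left fractions c i / u i have a common denominator. *)
Lemma common_multiple (I : eqType) (l : seq I) (c u : I -> A) :
    (forall i, S (u i)) ->
  exists x r, S x /\ forall i, i \in l -> x * c i = r i * u i.
Proof.
move=> Su; elim: l => [|j l [x [r [Sx xP]]]].
  by exists 1, (fun=> 0); split; first exact: denominator1.
have [r' [s' [Ss' e]]] := denominator_ore denS (x * c j) (Su j).
exists (s' * x), (fun i => if i == j then r' else s' * r i); split.
  exact: denominatorM.
move=> i; rewrite inE; case: eqVneq => [-> _|_ /= /xP xi].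
  by rewrite -mulrA e.
by rewrite -!mulrA xi.
Qed.

(** The graph of a homomorphism from P to the localization of N at S: Gam p q
    holds when p is sent to q / 1. Density makes it everywhere defined after
    localization. Exact functionality, rather than functionality up to
    S-torsion, is what torsion-free targets N allow. *)
Record partial_map (P N : lmodType A) (Gam : P -> N -> Prop) : Prop :=
  PartialMap {
  partial_map_lin : forall a p p' q q',
    Gam p q -> Gam p' q' -> Gam (a *: p + p') (a *: q + q');
  partial_map_dense : forall p, exists s q, S s /\ Gam (s *: p) q;
  partial_map_fun : forall q, Gam 0 q -> q = 0
}.

Section PartialMap.
Variables (P N : lmodType A) (Gam : P -> N -> Prop).
Hypothesis gamP : partial_map Gam.

Lemma partial_map0 : Gam 0 0.
Proof.
have [s [q [_]]] := partial_map_dense gamP 0; rewrite scaler0 => /[dup] gq.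
by move=> /(partial_map_fun gamP) q0; move: gq; rewrite q0.
Qed.

Lemma partial_map_sum (I : Type) (l : seq I) (r : I -> A) u v :
    (forall i, Gam (u i) (v i)) ->
  Gam (\sum_(i <- l) r i *: u i) (\sum_(i <- l) r i *: v i).
Proof.
move=> g; elim: l => [|i l IHl]; first by rewrite !big_nil; apply: partial_map0.
by rewrite !big_cons; apply: partial_map_lin.
Qed.

End PartialMap.

Section PartialLift.
Variables (P N : lmodType A).
Hypothesis projP : projective P.
Variable C : P -> N -> Prop.
Hypothesis C_lin : forall (r : free_module A P) u v,
  (forall i, C (u i) (v i)) -> C (free_eval u r) (free_eval v r).
Hypothesis C_dense : forall x, exists s q, S s /\ C (s *: x) q.

(** Projectivity of P after localization. If every x in P has an
    S-multiple s_ x x related to some q_ x by C, then x is to be sent to the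
    fraction (s_ x)^-1 (q_ x). On p = sum of lam_x(p) x this is defined
    without fractions when each lam_x(p) is of the form r_x s_x, and its value
    is then the sum of the r_x q_x. *)
Lemma partial_lift :
  exists2 Gam : P -> N -> Prop, partial_map Gam & forall p q, Gam p q -> C p q.
Proof.
have [lam lamK] := dual_basis projP.
have [s_ /choice[q_ sq]] := choice C_dense.
have Ss x : S (s_ x) by case: (sq x).
have Cs x : C (s_ x *: x) (q_ x) by case: (sq x).
exists (fun p q => exists2 r : free_module A P,
    forall x, lam p x = r x * s_ x & q = free_eval q_ r); last first.
  move=> p _ [r lamE ->]; rewrite -[p]lamK.
  suff -> : free_eval id (lam p) = free_eval (fun x => s_ x *: x) r.
    exact: C_lin.
  have r0 x : ~ finsupp (lam p) x -> r x = 0.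
    move=> nl; have := notin_finsupp nl; rewrite lamE => rs0.
    case: (domA rs0) => // sx0.
    by have := denominator_neq0 denS (Ss x); rewrite sx0 eqxx.
  rewrite free_eval_supp (free_evalE _ (free_moduleP (lam p)) r0).
  by apply: eq_bigr => x _; rewrite lamE scalerA.
split.
- move=> a p p' _ _ [r rP ->] [r' r'P ->]; exists (a *: r + r').
    move=> x; rewrite linearP free_coordD free_coordZ rP r'P.
    by rewrite free_coordD free_coordZ mulrDl mulrA.
  by rewrite linearP.
- move=> p; have [x [r [Sx xP]]] := @common_multiple _
    (fset_set (finsupp (lam p))) (lam p) s_ Ss.
  have [r' r'P] := free_module_of_fset (fset_set (finsupp (lam p))) r.
  exists x, (free_eval q_ r'); split=> //; exists r' => // y.
  rewrite linearZ free_coordZ r'P; case: ifPn => [/xP //|].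
  rewrite in_fset_set ?notin_setE; last exact: free_moduleP.
  by move=> nl; rewrite (notin_finsupp nl) mulr0 mul0r.
- move=> _ [r rP ->]; suff -> : r = 0 by rewrite linear0.
  apply: val_inj; apply/funext => x.
  have rs0 : r x * s_ x = 0 by rewrite -rP linear0.
  case: (domA rs0) => // sx0.
  by have := denominator_neq0 denS (Ss x); rewrite sx0 eqxx.
Qed.
End PartialLift.
End Localization.

(** * Syzygies of projective resolutions *)

Section AugmentedComplex.
Variables (A : nzRingType) (M : lmodType A) (Q : projective_resolution M).

(** The resolved module is put in degree 0 and Q d in degree d + 1, so that
    exactness is the same statement in all degrees. *)
Definition augmented_chain (k : nat) : lmodType A :=
  if k is d.+1 then Q d else M.

Definition augmented_boundary (k : nat) :
    {linear augmented_chain k.+1 -> augmented_chain k} :=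
  if k is d.+1 return {linear augmented_chain k.+1 -> augmented_chain k}
  then boundary Q d else augmentation Q.

Lemma augmented_exact k p : augmented_boundary k p = 0 <->
  exists q, augmented_boundary k.+1 q = p.
Proof. by case: k p => [|k] p; [exact: exact_at_0 | exact: exact_at_S]. Qed.

Lemma augmented_boundaryK k q :
  augmented_boundary k (augmented_boundary k.+1 q) = 0.
Proof. by apply/augmented_exact; exists q. Qed.

Lemma augmented_projective k : projective (augmented_chain k.+1).
Proof. exact: chain_projective. Qed.

Definition syzygy k := image_module (augmented_boundary k).

End AugmentedComplex.

Lemma projective_retract (A : nzRingType) (P K : lmodType A)
    (s : {linear K -> P}) (d : {linear P -> K}) :
  projective P -> (forall z, d (s z) = z) -> projective K.
Proof.
move=> projP sK M N f g fsurj; have [h hP] := projP M N f (g \o d) fsurj.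
by exists (h \o s) => z /=; rewrite hP /= sK.
Qed.

(** The lifting property asks for a surjection, and f becomes one when it is
    corestricted to its image. *)
Lemma projective_lift (A : nzRingType) (P U V : lmodType A)
    (f : {linear U -> V}) (g : {linear P -> V}) : projective P ->
    (forall p, exists u, f u = g p) ->
  exists h : {linear P -> U}, forall p, f (h p) = g p.
Proof.
move=> projP gim.
have gim' p : g p \in image_pred f by apply/asboolP.
pose g' p := ImageModule (gim' p).
have g'lin : linear g' by move=> a x y; apply: val_inj; rewrite /= linearP.
pose G := HB.pack_for {linear P -> image_module f} g'
  (GRing.isLinear.Build _ _ _ _ g' g'lin).
have [h hP] := projP _ _ (corestrict f) G (@corestrict_surj _ _ _ f).
by exists h => p; have /(congr1 (@image_val _ _ _ f)) := hP p.
Qed.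

Section Comparison.
Variables (A : nzRingType) (M : lmodType A) (Q P : projective_resolution M).

Local Notation dQ := (augmented_boundary Q).
Local Notation dP := (augmented_boundary P).

(** One level of the homotopy equivalence between two resolutions: chain maps g
    and f and the homotopy h from f o g to the identity. The full homotopy
    identity has a further term h (d x), which vanishes on boundaries; stating
    it on boundaries only lets the induction forget the previous levels. *)
Lemma comparison k :
  exists (g : {linear augmented_chain Q k -> augmented_chain P k})
    (f : {linear augmented_chain P k -> augmented_chain Q k})
    (h : {linear augmented_chain Q k -> augmented_chain Q k.+1}),
  [/\ forall x, exists y, dP k y = g (dQ k x),
      forall y, exists x, dQ k x = f (dP k y) &
      forall x, f (g (dQ k x)) + dQ k (h (dQ k x)) = dQ k x].
Proof.
elim: k => [|k [g [f [h [gP fP hP]]]]].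
  exists idfun, idfun, (\0 : {linear _ -> _}); split => [x|y|x] /=.
  - by have [y yP] := augmentation_surjective P (augmentation Q x); exists y.
  - by have [x xP] := augmentation_surjective Q (augmentation P y); exists x.
  - by rewrite linear0 addr0.
have [g' g'P] := projective_lift (g := g \o dQ k)
  (@augmented_projective _ _ Q k) gP.
have [f' f'P] := projective_lift (g := f \o dP k)
  (@augmented_projective _ _ P k) fP.
have [x|h' h'P] := projective_lift (f := dQ k.+1)
  (g := (idfun \- (f' \o g') \- (h \o dQ k) : {linear _ -> _}))
  (@augmented_projective _ _ Q k).
  apply/augmented_exact; rewrite /= !linearB /= f'P /= g'P /= -{1}[dQ k x]hP.
  by rewrite -addrA -opprD subrr.
exists g', f', h'; split => [x|y|x].
- by apply/augmented_exact; rewrite g'P /= augmented_boundaryK linear0.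
- by apply/augmented_exact; rewrite f'P /= augmented_boundaryK linear0.
- by rewrite h'P /= augmented_boundaryK linear0 subr0 addrC subrK.
Qed.

(** Going to P and back, the homotopy exhibits the n-th syzygy z = f (g z) + d
    (h z) as a retract of the projective module mapping onto it. Since P ends
    in degree n, its last boundary map is injective, so g z lifts to P n in a
    unique, hence linear, way. *)
Lemma syzygy_projective n : length_at_most P n -> projective (syzygy Q n).
Proof.
move=> lenP; have [g [f [h [gP fP hP]]]] := comparison n.
have [f' f'P] := projective_lift (g := f \o dP n)
  (@augmented_projective _ _ P n) fP.
have dPinj : injective (dP n).
  move=> x y /eqP; rewrite -subr_eq0 -linearB => /eqP/augmented_exact[z].
  rewrite (_ : z = 0) ?linear0; last exact: lenP.
  by move/esym/eqP; rewrite subr_eq0 => /eqP.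
have /choice[b bP] (z : syzygy Q n) : exists b, dP n b = g (image_val z).
  by have [x <-] := image_moduleP z; exact: gP.
have b_lin : linear b.
  by move=> a x y; apply: dPinj; rewrite linearP !bP !linearP.
pose B := HB.pack_for {linear syzygy Q n -> augmented_chain P n.+1} b
  (GRing.isLinear.Build _ _ _ _ b b_lin).
pose s : {linear syzygy Q n -> augmented_chain Q n.+1} :=
  (f' \o B) \+ (h \o @image_val _ _ _ (dQ n)).
apply: (@projective_retract _ (augmented_chain Q n.+1) _ s (corestrict (dQ n))).
  exact: augmented_projective.
move=> z; apply: image_val_inj => /=; rewrite linearD f'P /= bP.
by have [x <-] := image_moduleP z; rewrite hP.
Qed.

End Comparison.

Section Homotopy.
Variables (A : nzRingType) (S : A -> Prop).
Hypotheses (domA : domain A) (denS : left_denominator_set S).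
Variables (M : lmodType A) (Q : projective_resolution M).
Hypothesis torsM : exists2 s, S s & forall m : M, s *: m = 0.

Local Notation C := (augmented_chain Q).
Local Notation d := (augmented_boundary Q).

(** The contracting homotopy of the localized augmented complex. It starts in
    degree 0 because S contains an element that kills M: the zero map is
    already defined on an S-dense submodule, namely 0. *)
Lemma partial_contraction k : exists2 Gam : C k -> C k.+1 -> Prop,
  partial_map S Gam & forall p q, Gam (d k p) q -> d k q = d k p.
Proof.
elim: k => [|k [Gam gamP gamE]].
  exists (fun p q => p = 0 /\ q = 0).
    split; first by move=> a p p' q q' [-> ->] [-> ->]; rewrite !scaler0 !addr0.
      by have [s Ss sM] := torsM => m; exists s, 0.
    by move=> q [].
  by move=> p q [-> ->]; rewrite linear0.
(* p = d (Gam' p) + Gam (d p), the homotopy identity to be solved for Gam' *)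
pose D (p : C k.+1) (q : C k.+2) :=
  exists2 q', Gam (d k p) q' & p = d k.+1 q + q'.
have [r u v Duv|x|Gam' gam'P gam'D] := @partial_lift _ _ domA denS
    (C k.+1) (C k.+2) (@augmented_projective _ _ Q k) D.
- have /choice[w wP] x : exists w, Gam (d k (u x)) w /\ u x = d k.+1 (v x) + w.
    by have [w ? ?] := Duv x; exists w.
  exists (free_eval w r).
    rewrite linear_free_eval !free_eval_supp.
    by apply: (partial_map_sum gamP) => x; case: (wP x).
  rewrite linear_free_eval -free_evalD !free_eval_supp; apply: eq_bigr => x _.
  by case: (wP x) => _ ->.
- have [s [q' [Ss]]] := partial_map_dense gamP (d k x).
  rewrite -linearZ => /[dup] g /gamE/eqP; rewrite eq_sym -subr_eq0 -linearB.
  move=> /eqP/augmented_exact[q qP]; exists s, q; split=> //.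
  by exists q' => //; rewrite qP subrK.
exists Gam' => // p q /gam'D[q']; rewrite augmented_boundaryK.
by move=> /(partial_map_fun gamP) -> ; rewrite addr0.
Qed.

(** The fractions z j / u j generate the localized syzygy, where Gam sends
    u j v j to q j and z j is the boundary of q j. Hence every element x of the
    syzygy has a multiple s x in the span of the z j. The coordinates of s x
    outside the finite set Y vanish, and those of x with them. *)
Lemma syzygy_finitely_generated n : projective (syzygy Q n) ->
  finitely_generated (C n) -> finitely_generated (syzygy Q n).
Proof.
move=> /dual_basis[lam lamK] [m [v vP]].
have [Gam gamP gamE] := partial_contraction n.
have /choice[u /choice[q uqP]] j := partial_map_dense gamP (v j).
have Su j : S (u j) by case: (uqP j).
pose z j := corestrict (d n) (q j).
pose Y := \big[fsetU/fset0]_(j < m) fset_set (finsupp (lam (z j))).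
have lamY x y : y \notin Y -> lam x y = 0.
  move=> yY; have [c xE] := vP (image_val x).
  have [s [r [Ss srP]]] := common_multiple denS (enum 'I_m) c Su.
  have sxE : s *: x = \sum_(j < m) r j *: z j.
    apply: image_val_inj; rewrite linearZ linear_sum /=.
    have [w xw] := image_moduleP x.
    have : Gam (s *: image_val x) (\sum_(j < m) r j *: q j).
      rewrite xE scaler_sumr.
      under eq_bigr => j _ do rewrite scalerA srP ?mem_enum// -scalerA.
      by apply: (partial_map_sum gamP) => j; case: (uqP j).
    rewrite -xw -linearZ => /gamE <-; rewrite linear_sum.
    by apply: eq_bigr => j _; rewrite !linearZ.
  have : lam (s *: x) y = 0.
    rewrite sxE linear_sum.
    suff : forall l, (\sum_(j <- l) lam (r j *: z j)) y = 0 by exact.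
    elim=> [|j l IHl]; first by rewrite big_nil.
    rewrite big_cons free_coordD IHl addr0 linearZ free_coordZ.
    suff ny : ~ finsupp (lam (z j)) y by rewrite (notin_finsupp ny) mulr0.
    move=> yl; move/negP: yY; apply; apply/bigfcupP; exists j => //.
      by rewrite mem_index_enum.
    by rewrite in_fset_set ?inE//; exact: free_moduleP.
  rewrite linearZ free_coordZ => /domA[] // s0.
  by have := denominator_neq0 denS Ss; rewrite s0 eqxx.
exists #|` Y|, (fun i => tnth (in_tuple Y) i) => x.
exists (fun i => lam x (tnth (in_tuple Y) i)).
rewrite -[LHS]lamK (@free_evalE _ _ _ _ [set` Y])//.
  by rewrite set_fsetK (big_tnth _ _ Y).
by move=> y /negP; exact: lamY.
Qed.

End Homotopy.

(** * Modules of type FP *)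

Definition module_FP (A : nzRingType) (M : lmodType A) : Prop :=
  exists P : projective_resolution M, (exists n, length_at_most P n) /\
    forall d, finitely_generated (P d).

Section Splice.
Variables (A : nzRingType) (M N P : lmodType A).
Variables (R : projective_resolution N).
Variables (i : {linear N -> P}) (e : {linear P -> M}).
Hypotheses (projP : projective P) (i_inj : injective i).
Hypothesis e_surj : forall m, exists p, e p = m.
Hypothesis exact_ie : forall p, e p = 0 <-> exists x, i x = p.

Definition splice_chain (d : nat) : lmodType A := if d is k.+1 then R k else P.
Definition splice_boundary d : {linear splice_chain d.+1 -> splice_chain d} :=
  if d is k.+1 return {linear splice_chain d.+1 -> splice_chain d}
  then boundary R k else i \o augmentation R.

Lemma splice : exists R' : projective_resolution M,
  forall d, R' d = splice_chain d.
Proof.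
have proj d : projective (splice_chain d).
  by case: d => [|d] //; exact: chain_projective.
have ex0 p : e p = 0 <-> exists q, splice_boundary 0 q = p.
  rewrite exact_ie; split=> [[x <-]|[q <-]]; last by eexists.
  by have [q <-] := augmentation_surjective R x; exists q.
have exS d p :
    splice_boundary d p = 0 <-> exists q, splice_boundary d.+1 q = p.
  case: d p => [|d] p; last exact: exact_at_S.
  rewrite -exact_at_0 /=; split=> [/eqP|->]; last by rewrite linear0.
  by rewrite -(linear0 i) => /eqP/i_inj.
by exists (ProjectiveResolution proj e_surj ex0 exS).
Qed.
End Splice.

Lemma module_FP_splice (A : nzRingType) (M N P : lmodType A)
    (i : {linear N -> P}) (e : {linear P -> M}) :
    projective P -> finitely_generated P -> injective i ->
    (forall m, exists p, e p = m) ->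
    (forall p, e p = 0 <-> exists x, i x = p) ->
  module_FP N -> module_FP M.
Proof.
move=> projP fgP i_inj e_surj ex [R [[n lenR] fgR]].
have [R' R'E] := splice R projP i_inj e_surj ex.
exists R'; split.
  by exists n.+1 => -[|d]// nd x; move: x; rewrite R'E => x; exact: lenR.
by case=> [|d]; rewrite R'E; [exact: fgP | exact: fgR].
Qed.

Lemma module_FP_projective (A : nzRingType) (M : lmodType A) :
  projective M -> finitely_generated M -> module_FP M.
Proof.
move=> projM fgM; pose O : lmodType A := 'rV[A]_0.
have O0 (x : O) : x = 0 by apply/rowP => -[].
have projO : projective O.
  by move=> U V f g _; exists \0 => x; rewrite (O0 x) !linear0.
have fgO : finitely_generated O.
  by exists 0, (fun=> 0) => x; exists (fun=> 0); rewrite (O0 x) big_ord0.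
pose C d : lmodType A := if d is k.+1 then O else M.
have projC d : projective (C d) by case: d.
have surj (m : M) : exists p, (idfun : {linear M -> M}) p = m by exists m.
have ex0 (p : C 0) : (idfun : {linear M -> M}) p = 0 <->
    exists q, (\0 : {linear C 1 -> C 0}) q = p.
  by split=> [/= ->|[q <-]//]; exists 0.
have exS d (p : C d.+1) : (\0 : {linear C d.+1 -> C d}) p = 0 <->
    exists q, (\0 : {linear C d.+2 -> C d.+1}) q = p.
  by rewrite (O0 p); split=> // _; exists 0.
exists (@ProjectiveResolution _ _ C (fun d => \0) idfun projC surj ex0 exS).
split; first by exists 0 => -[|d]// _ x; exact: O0.
by case.
Qed.

Lemma module_FP_iso (A : nzRingType) (M N : lmodType A) (f : {linear N -> M}) :
  injective f -> (forall m, exists x, f x = m) -> module_FP N -> module_FP M.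
Proof.
move=> f_inj f_surj [R [lenR fgR]].
have surj m : exists p, (f \o augmentation R) p = m.
  have [x <-] := f_surj m.
  by have [p <-] := augmentation_surjective R x; exists p.
have ex0 p : (f \o augmentation R) p = 0 <-> exists q, boundary R 0 q = p.
  rewrite -exact_at_0 /=; split=> [/eqP|->]; last by rewrite linear0.
  by rewrite -(linear0 f) => /eqP/f_inj.
by exists (ProjectiveResolution (@chain_projective _ _ R) surj ex0
  (@exact_at_S _ _ R)).
Qed.

(** Truncating a resolution at a finitely generated projective syzygy. The
    truncated complex is assembled from its end by splicing, which avoids a
    chain complex whose modules are defined by cases on the degree. *)
Lemma syzygy_FP (A : nzRingType) (M : lmodType A)
    (Q : projective_resolution M) n :
    projective (syzygy Q n) -> finitely_generated (syzygy Q n) ->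
    (forall d, (d < n)%N -> finitely_generated (Q d)) ->
  module_FP M.
Proof.
move=> projK fgK fgQ.
suff FP0 : module_FP (syzygy Q 0).
  apply: module_FP_iso FP0.
    exact: (@image_val_inj _ _ _ (augmented_boundary Q 0)).
  move=> m; have [p pm] := augmentation_surjective Q m.
  by exists (corestrict (augmented_boundary Q 0) p).
have : module_FP (syzygy Q n) by exact: module_FP_projective.
elim: n {projK fgK} fgQ => // n IHn fgQ FPn; apply: IHn => [d dn|].
  by apply: fgQ; exact: ltnW.
apply: module_FP_splice FPn => //.
- exact: (@augmented_projective _ _ Q n).
- exact: fgQ.
- exact: (@image_val_inj _ _ _ (augmented_boundary Q n.+1)).
- exact: (@corestrict_surj _ _ _ (augmented_boundary Q n)).
- move=> p; split=> [/(congr1 (@image_val _ _ _ _)) /=|].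
    move/augmented_exact => [q <-].
    by exists (corestrict (augmented_boundary Q n.+1) q).
  move=> [x <-]; apply: image_val_inj => /=; have [q <-] := image_moduleP x.
  exact: augmented_boundaryK.
Qed.

(** * Independent rows have a matching *)

Lemma common_denominator (I : finType) (v : I -> rat) :
  exists (D : int) (z : I -> int), D != 0 /\ forall i, D%:~R * v i = (z i)%:~R.
Proof.
exists (\prod_i denq (v i)).
exists (fun i => (\prod_(k | k != i) denq (v k)) * numq (v i)).
split=> [|i]; first by apply/prodf_neq0 => i _; exact: denq_neq0.
rewrite (bigD1 i)//= [denq _ * _]mulrC !intrM -mulrA; congr (_ * _).
by rewrite -{2}(divq_num_den (v i)) mulrC divfK// intr_eq0 denq_neq0.
Qed.

(** Over the rationals, some maximal minor is nonzero, and so is some term of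
    its Leibniz expansion: a permutation along which no entry vanishes. *)
Lemma independent_rows_matching (I J : finType) (M : I -> J -> int) :
    (forall c : I -> int, (forall j, \sum_i c i * M i j = 0) ->
       forall i, c i = 0) ->
  exists2 f : I -> J, injective f & forall i, M i (f i) != 0.
Proof.
move=> indep.
pose A : 'M[rat]_(#|I|, #|J|) :=
  \matrix_(i, j) (M (enum_val i) (enum_val j))%:~R.
have freeA : row_free A.
  apply: inj_row_free => v vA0.
  have [D [z [D0 zP]]] := common_denominator (fun i : I => v 0 (enum_rank i)).
  have z0 := indep z _; apply/rowP => i; rewrite mxE.
  have /eqP := zP (enum_val i); rewrite z0 => [|j].
    by rewrite enum_valK mulf_eq0 intr_eq0 (negPf D0) => /eqP.
  apply/eqP; rewrite -(intr_eq0 rat) rmorph_sum /=; apply/eqP.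
  transitivity (D%:~R * (v *m A) 0 (enum_rank j)); last by rewrite vA0 mxE mulr0.
  rewrite mxE mulr_sumr (reindex_onto enum_rank enum_val) /=; last first.
    by move=> k _; rewrite enum_valK.
  apply: eq_big => [k|k _]; rewrite ?enum_rankK ?eqxx//.
  by rewrite mxE !enum_rankK mulrA zP intrM.
have fullAT : row_full A^T by rewrite /row_full mxrank_tr.
set g := fullrankfun fullAT.
have /existsP[s] : [exists s : 'S_#|I|, \prod_i A (s i) (g i) != 0].
  apply/existsPn => /= s0; suff : \det (rowsub g A^T) != 0.
    rewrite /determinant big1 ?eqxx// => s _.
    under eq_bigr => i _ do rewrite !mxE.
    have := s0 s; rewrite negbK => /eqP.
    under eq_bigr => i _ do rewrite mxE.
    by move=> ->; rewrite mulr0.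
  by have := fullrowsub_unit fullAT; rewrite unitmxE unitfE.
move=> /prodf_neq0 sP.
exists (fun i => enum_val (g ((s^-1)%g (enum_rank i)))) => [i i'|i].
  by move=> /enum_val_inj/fullrankfun_inj/perm_inj/enum_rank_inj.
have := sP ((s^-1)%g (enum_rank i)) isT.
by rewrite permKV mxE enum_rankK intr_eq0.
Qed.

(** * The space of matchings *)

Section Cylinders.
Variables (X : eqType) (V : discreteTopologicalType).

Lemma cylinder1_open (x : X) (E : set V) :
  open [set f : {ptws X -> V} | E (f x)].
Proof.
apply: (@open_comp _ _ (fun f : {ptws X -> V} => f x) E);
  last exact: discrete_open.
by move=> f _; exact: (@proj_continuous X (fun=> V) x f).
Qed.

Lemma cylinder2_open (x y : X) (E : V -> V -> Prop) :
  open [set f : {ptws X -> V} | E (f x) (f y)].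
Proof.
rewrite [X in open X](_ : _ = \bigcup_(v in [set: V])
    ([set f : {ptws X -> V} | f x = v] `&`
     [set f : {ptws X -> V} | E v (f y)])).
  apply: bigcup_open => v _.
  apply: openI; first exact: (cylinder1_open x [set v]).
  exact: cylinder1_open.
by apply/seteqP; split=> [f Ef|f [v _ [<-]]//]; exists (f x).
Qed.

Lemma cylinder1_closed (x : X) (E : set V) :
  closed [set f : {ptws X -> V} | E (f x)].
Proof. by rewrite -openC; exact: (cylinder1_open x (~` E)). Qed.

Lemma cylinder2_closed (x y : X) (E : V -> V -> Prop) :
  closed [set f : {ptws X -> V} | E (f x) (f y)].
Proof. by rewrite -openC; exact: (cylinder2_open x y (fun v w => ~ E v w)). Qed.

End Cylinders.

Lemma reindex_continuous (X : eqType) (V : topologicalType) (s : X -> X) :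
  continuous (fun f : {ptws X -> V} => (fun x => f (s x)) : {ptws X -> V}).
Proof.
pose g := (fun f : {ptws X -> V} => (fun x => f (s x)) : {ptws X -> V}).
move=> f; have F : Filter (g @ f) by apply: fmap_filter; apply: nbhs_filter.
have [_ gf] := @cvg_sup _ _ (fun i => Topological.class
  (initial_topology (fun h : (forall i : X, V) => h i))) (g @ f) (g f) F.
apply: gf => x A [/= _ [[W oW <-] Wf] sWA].
apply: (@filterS _ (nbhs f) _ [set h : {ptws X -> V} | W (h (s x))]).
  by move=> h Wh; exact: sWA.
apply: open_nbhs_nbhs; split; last exact: Wf.
apply: (@open_comp _ _ (fun h : {ptws X -> V} => h (s x)) W) => // h _.
exact: (@proj_continuous X (fun=> V) (s x) h).
Qed.

(** A matching of H x 'I_p into H x 'I_q that displaces the H-component by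
    elements of a fixed finite set is recorded by its displacements f x in L.
    Recorded in this way, matchings form a closed subset of a product of finite
    discrete spaces, and left translation by H merely permutes the factors. *)
Section MatchingSpace.
Variables (H : groupType) (p q : nat) (L : {fset (H * 'I_q)%type}).

Definition shift_space : topologicalType :=
  {ptws (H * 'I_p)%type -> discrete_topology (H * 'I_q)%type}.

Definition matched (f : shift_space) (x : H * 'I_p) : H * 'I_q :=
  ((x.1 * (f x).1)%g, (f x).2).

Definition partial_matchings (F : set (H * 'I_p)) : set shift_space :=
  [set f | (forall x, f x \in L) /\
     forall x y, F x -> F y -> matched f x = matched f y -> x = y].

Definition matchings := partial_matchings setT.

Lemma shift_space_hausdorff : hausdorff_space shift_space.
Proof. by apply: hausdorff_product => x; exact: discrete_hausdorff. Qed.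

Lemma partial_matchings_compact F : compact (partial_matchings F).
Proof.
pose K : set shift_space := [set f | forall x, f x \in L].
apply: (@subclosed_compact _ _ K); last by move=> f [].
- rewrite (_ : partial_matchings F = K `&` \bigcap_(x in F) \bigcap_(y in F)
      [set f | matched f x = matched f y -> x = y]); last first.
    apply/seteqP; split=> f [fL fF]; split=> // x.
      by move=> Fx y Fy; exact: fF.
    by move=> y Fx Fy; exact: (fF x Fx y Fy).
  apply: closedI.
    rewrite (_ : K = \bigcap_(x in setT) [set f | f x \in L]); last first.
      by apply/seteqP; split=> [f fL x _|f fL x]; [exact: fL | exact: fL].
    apply: closed_bigI => x _.
    exact: (@cylinder1_closed _ (discrete_topology (H * 'I_q)%type)
      x (fun v => v \in L)).
  apply: closed_bigI => x _; apply: closed_bigI => y _.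
  exact: (@cylinder2_closed _ (discrete_topology (H * 'I_q)%type) x y
    (fun v w => ((x.1 * v.1)%g, v.2) = ((y.1 * w.1)%g, w.2) -> x = y)).
- apply: (@tychonoff (H * 'I_p)%type (fun=> discrete_topology (H * 'I_q)%type)
    (fun=> [set` L])) => x.
  by apply: finite_compact; exact: finite_fset.
Qed.

(** A cluster point of partial matchings defined on larger and larger finite
    sets is a matching on each of them, since these conditions are closed. *)
Lemma matchings_nonempty :
  (forall F : {fset (H * 'I_p)%type}, partial_matchings [set` F] !=set0) ->
  matchings !=set0.
Proof.
move=> locM.
pose B (F : {fset (H * 'I_p)%type}) := partial_matchings [set` F].
have BS (F F' : {fset (H * 'I_p)%type}) : {subset F <= F'} -> B F' `<=` B F.
  move=> FF' f [fL fF']; split=> // x y Fx Fy; apply: fF'; exact: FF'.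
have FF : ProperFilter (filter_from setT B).
  apply: filter_from_proper; last by move=> F _; exact: locM.
  apply: filter_from_filter; first by exists fset0.
  move=> F F' _ _; exists (F `|` F')%fset => // f fFF'; split.
    by apply: BS fFF' => x; rewrite inE => ->.
  by apply: BS fFF' => x; rewrite inE orbC => ->.
have FB0 : filter_from setT B (B fset0) by exists fset0.
have [f [[fL _] cf]] := partial_matchings_compact FF FB0.
exists f; split=> // x y _ _.
pose F := [fset x; y]%fset.
have closedF : closed (B F).
  apply: compact_closed; first exact: shift_space_hausdorff.
  exact: partial_matchings_compact.
have : closure (B F) f.
  by move=> U nU; apply: cf => //; exists F.
by move=> /closedF[_]; apply; rewrite /= !inE eqxx ?orbT.
Qed.

Definition translate (g : H) (f : shift_space) : shift_space :=
  fun x => f ((g^-1 * x.1)%g, x.2).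

Lemma translate_continuous g : continuous (translate g).
Proof.
exact: (@reindex_continuous _ (discrete_topology (H * 'I_q)%type)
  (fun x => ((g^-1 * x.1)%g, x.2))).
Qed.

Lemma translate1 f : translate 1%g f = f.
Proof. by apply/funext => -[h i]; rewrite /translate /= invg1 mul1g. Qed.

Lemma translateM g h f : translate (g * h)%g f = translate g (translate h f).
Proof. by apply/funext => -[k i]; rewrite /translate /= invgM mulgA. Qed.

Lemma translate_matchings g f : matchings f -> matchings (translate g f).
Proof.
move=> [fL finj]; split=> [x|[h i] [k j] _ _ [e1 e2]]; first exact: fL.
suff [/mulgI -> ->] : ((g^-1 * h)%g, i) = ((g^-1 * k)%g, j) by [].
apply: finj => //; rewrite /matched /= -!mulgA.
by congr (_, _); [rewrite e1 | exact: e2].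
Qed.
End MatchingSpace.

Lemma measure_bigsetU_seq d (T : measurableType d) (R : realType)
    (mu : {measure set T -> \bar R}) (K : choiceType) (l : seq K)
    (F : K -> set T) :
    uniq l -> (forall k, measurable (F k)) ->
    {in l &, forall k k', k != k' -> F k `&` F k' = set0} ->
  mu (\big[setU/set0]_(k <- l) F k) = (\sum_(k <- l) mu (F k))%E.
Proof.
move=> + mF; elim: l => [|k l IHl] /=; first by rewrite !big_nil measure0.
move=> /andP[kl ul] disj; rewrite !big_cons measureU//; last 2 first.
- exact: bigsetU_measurable.
- rewrite -bigcup_seq setI_bigcupr bigcup0// => k' /= k'l.
  apply: disj; rewrite ?inE ?eqxx ?k'l ?orbT//.
  by apply: contraNneq kl => ->.
congr (_ + _)%E; apply: IHl => // x y xl yl.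
by apply: disj; rewrite inE ?xl ?yl orbT.
Qed.

Lemma injective_continuous_hausdorff (X Y : topologicalType) (f : X -> Y) :
  continuous f -> injective f -> hausdorff_space Y -> hausdorff_space X.
Proof.
move=> fc f_inj hY x y cl; apply: f_inj; apply: hY => A B /fc fA /fc fB.
by have [z [Az Bz]] := cl _ _ fA fB; exists (f z).
Qed.

Lemma compact_set_type (Y : topologicalType) (C : set Y) :
  compact C -> compact [set: set_type C].
Proof.
move=> compC F FF _; pose v : set_type C -> Y := set_val.
have FC : (v @ F) C.
  suff vC : v @^-1` C = setT by rewrite /nbhs /= vC; exact: filterT.
  by apply/seteqP; split=> // w _; exact: set_valP.
have [y [Cy cly]] := compC (v @ F) _ FC.
exists (SigSub (mem_set Cy)); split=> // A B FA [_ [[W oW <-] Wy] sWB].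
have yW : nbhs y W by exact: open_nbhs_nbhs.
have FvA : (v @ F) (v @` A).
  by apply: (@filterS _ F _ A) => // w Aw; exists w.
have [_ [[w Aw <-] Ww]] := cly _ _ FvA yW.
by exists w; split=> //; exact: sWB.
Qed.

(** Mass transport. Under an invariant law, the probability that (h, i) is
    displaced by v does not depend on h. The points that are sent to (1, j)
    are the (s^-1, i) displaced by (s, j); these events are disjoint by
    injectivity, so their probabilities add up to at most 1. Summed over j, the
    same probabilities, transported to (1, i), add up to p. *)
Lemma amenable_matching_bound (R : realType) (H : groupType) (p q : nat)
    (L : {fset (H * 'I_q)%type}) :
  amenable R H -> @matchings H p q L !=set0 -> (p <= q)%N.
Proof.
move=> amenH [f0 f0M]; pose C := @matchings H p q L.
pose w0 : C := SigSub (mem_set f0M).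
pose X : ptopologicalType := HB.pack_for ptopologicalType (set_type C)
  (isPointed.Build (set_type C) w0).
pose valX : X -> shift_space H p q := set_val.
have valXM (w : X) : C (valX w) by exact: set_valP.
pose actX (g : H) (w : X) : X :=
  SigSub (mem_set (translate_matchings g (valXM w))).
have valX_inj : injective valX by exact: val_inj.
have valXact g w : valX (actX g w) = translate g (valX w) by [].
have actX1 w : actX 1%g w = w by apply: valX_inj; rewrite valXact translate1.
have actXM g h w : actX (g * h)%g w = actX g (actX h w).
  by apply: valX_inj; rewrite !valXact translateM.
have valXc : continuous valX by exact: initial_continuous.
have actXc g : continuous (actX g).
  apply/continuousP => _ [B oB <-].
  rewrite (_ : _ @^-1` _ = valX @^-1` (translate g @^-1` B))//.
  have /continuousP vo := valXc; apply: vo.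
  by have /continuousP := @translate_continuous H p q g; exact.
have compX : compact [set: X] :=
  compact_set_type (@partial_matchings_compact H p q L setT).
have hausX : hausdorff_space X :=
  injective_continuous_hausdorff valXc valX_inj (@shift_space_hausdorff H p q).
have [mu muP] := amenH X (ContinuousAction actX1 actXM actXc) compX hausX.
pose E (x : H * 'I_p) (v : H * 'I_q) : set (g_sigma_algebraType (@open X)) :=
  [set w : X | valX w x = v].
have mE x v : measurable (E x v).
  apply: sub_sigma_algebra; rewrite (_ : E x v = valX @^-1` [set f | f x = v])//.
  have /continuousP vo := valXc; apply: vo.
  exact: (@cylinder1_open _ (discrete_topology (H * 'I_q)%type) x [set v]).
have muE h i v : mu (E (h, i) v) = mu (E (1%g, i) v).
  rewrite -(muP h^-1%g (E (1%g, i) v))//; congr (mu _).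
  apply/seteqP; split=> w; rewrite /E /= valXact /translate /= invgK mulg1 //.
have total i : (\sum_(v <- L) mu (E (1%g, i) v) = 1)%E.
  rewrite -(measure_bigsetU_seq mu (fset_uniq L) (mE _)) => [|v v' _ _ vv'].
    rewrite -(@probability_setT _ _ _ mu); congr (mu _); apply/seteqP.
    split=> // w _; rewrite -bigcup_seq; exists (valX w (1%g, i)) => //=.
    by case: (valXM w).
  apply/seteqP; split=> // w []; rewrite /E /= => e e'.
  by move: vv'; rewrite -e -e' eqxx.
pose K := [seq (i, v) | i <- enum 'I_p, v <- L].
have uK : uniq K.
  apply: allpairs_uniq => [||[i v] [i' v'] _ _ //]; first exact: enum_uniq.
  exact: fset_uniq.
pose F (k : 'I_p * (H * 'I_q)) := E (k.2.1^-1%g, k.1) k.2.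
have arrive j : (\sum_(k <- K | k.2.2 == j) mu (F k) <= 1)%E.
  rewrite -big_filter.
  rewrite -(measure_bigsetU_seq mu (filter_uniq _ uK) (F := F)) => [|k|].
  - apply: probability_le1; apply: bigsetU_measurable => k _; exact: mE.
  - exact: mE.
  move=> [i v] [i' v']; rewrite !mem_filter /=.
  move=> /andP[/eqP vj _] /andP[/eqP v'j _].
  move=> kk'; apply/seteqP; split=> // w [/= e e']; case/eqP: kk'.
  have [_ inj] := valXM w; have := inj (v.1^-1%g, i) (v'.1^-1%g, i') I I.
  rewrite /matched /= e e' !mulVg vj v'j => /(_ erefl)[/invg_inj v1 <-].
  by rewrite [v]surjective_pairing [v']surjective_pairing v1 vj v'j.
rewrite -(ler_nat R) -lee_fin.
have -> : ((p%:R : R)%:E = \sum_(k <- K) mu (F k))%E.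
  rewrite /K big_allpairs big_enum /=.
  under eq_bigr => i _.
    under eq_bigr => v _ do rewrite /F /= muE.
    rewrite total; over.
  by rewrite sumEFin sumr_const card_ord.
rewrite (partition_big (fun k => k.2.2) xpredT)//=.
have -> : ((q%:R : R)%:E = \sum_(j < q) 1)%E.
  by rewrite sumEFin sumr_const card_ord.
by apply: lee_sum => j _; exact: arrive.
Qed.

(** * Amenable groups satisfy the strong rank condition *)

Section GroupElements.
Variables (K : nzRingType) (G : groupType).

Lemma groupRing_sumE (I : Type) (l : seq I) (P : pred I)
    (F : I -> groupRing K G) g :
  (\sum_(i <- l | P i) F i) g = \sum_(i <- l | P i) F i g.
Proof. by apply: (big_morph (fun a : groupRing K G => a g)). Qed.

Lemma groupRing_mulrzE (a : groupRing K G) (z : int) g : (a *~ z) g = a g *~ z.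
Proof.
have mulrnE n : (a *+ n) g = a g *+ n.
  by elim: n => [|n IHn]; rewrite ?mulr0n// !mulrSr -IHn.
case: z => n; first exact: mulrnE.
by rewrite NegzE !mulrNz -!pmulrn -mulrnE.
Qed.

Let group_elt_subproof (x : G) : (fun g => (g == x)%:R : K) \in finsupp_pred K G.
Proof.
apply/asboolP; apply: (sub_finite_set _ (finite_set1 x)) => g.
by rewrite /finsupp/=; case: (eqVneq g x) => // _; rewrite eqxx.
Qed.
Definition group_elt x := GroupRing (group_elt_subproof x).

Lemma group_eltM x (a : groupRing K G) g : (group_elt x * a) g = a (x^-1 * g)%g.
Proof.
transitivity (convolution (group_elt x) a g); first by [].
rewrite /convolution (fsum_delta (j := (x^-1 * g)%g)) /=.
  by rewrite invgM invgK mulKVg eqxx mul1r.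
move=> h hx; case: eqP => [xE|_]; last by rewrite mul0r.
by move: hx; rewrite -xE invgM invgK mulgVK eqxx.
Qed.

End GroupElements.

Lemma in_finsupp (K : nzRingType) (G : groupType) (a : groupRing K G) g :
  (g \in fset_set (finsupp a)) = (a g != 0).
Proof.
by rewrite in_fset_set; [apply/idP/idP; rewrite inE | exact: groupRingP].
Qed.

(** If the rows of a were independent, then for every finite F the elements
    (h, i) of F would index independent rows h a_i of an integral matrix,
    whose nonzero entries are in columns (h s, j) with s in the support of
    a i j. A matching along nonzero entries has its displacements in L. *)
Lemma strong_rank_condition (R : realType) (H : groupType) (p q : nat)
    (a : 'I_p -> 'I_q -> groupRing int H) : amenable R H -> (q < p)%N ->
  exists c : 'I_p -> groupRing int H, (exists i, c i != 0) /\
    forall j, \sum_i c i * a i j = 0.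
Proof.
move=> amenH; rewrite ltnNge => /negP pq; apply: contrapT => nc; apply: pq.
have indep c : (forall j, \sum_i c i * a i j = 0) -> forall i, c i = 0.
  move=> c0 i; apply/eqP; apply: contrapT => /negP ci.
  by apply: nc; exists c; split; first by exists i.
pose L := (\big[fsetU/fset0]_(i < p) \big[fsetU/fset0]_(j < q)
  [fset (s, j) | s in fset_set (finsupp (a i j))])%fset.
have inL i j s : a i j s != 0 -> (s, j) \in L.
  move=> aijs; apply/bigfcupP; exists i; first by rewrite mem_index_enum.
  apply/bigfcupP; exists j; first by rewrite mem_index_enum.
  by apply/imfsetP; exists s => //=; rewrite in_finsupp.
have [->//|p0] := posnP p.
apply: (amenable_matching_bound (L := L) amenH).
apply: matchings_nonempty => F0.
(* (1, 0) is added only to make F nonempty *)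
pose F := ((1%g, Ordinal p0) |` F0)%fset.
pose J := [fset ((x.1 * v.1)%g, v.2) | x in F, v in L]%fset.
pose M (x : F) (y : J) : int :=
  a (fsval x).2 (fsval y).2 ((fsval x).1^-1 * (fsval y).1)%g.
have [c cM|f f_inj fM] := @independent_rows_matching F J M.
  pose C i := \sum_(x : F | (fsval x).2 == i) group_elt int (fsval x).1 *~ c x.
  have C0 i : C i = 0.
    apply: indep i => j; apply: val_inj; apply/funext => g.
    transitivity (\sum_(x : F) a (fsval x).2 j ((fsval x).1^-1 * g)%g *~ c x).
      rewrite (partition_big (fun x : F => (fsval x).2) xpredT)//= groupRing_sumE.
      apply: eq_bigr => i _; rewrite mulr_suml groupRing_sumE.
      apply: eq_bigr => x /eqP <-.
      by rewrite mulrzAl groupRing_mulrzE group_eltM.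
    have [gJ|gJ] := boolP ((g, j) \in J).
      rewrite -[RHS](cM (FSetSub gJ)); apply: eq_bigr => x _.
      by rewrite /M /= -mulrzr intz mulrC.
    rewrite big1// => x _.
    have [->|ax] := eqVneq (a (fsval x).2 j ((fsval x).1^-1 * g)%g) 0.
      by rewrite mul0rz.
    case/negP: gJ; apply/imfset2P; exists (fsval x); first exact: fsvalP.
    exists ((fsval x).1^-1 * g, j)%g; first exact: inL ax.
    by rewrite /= mulKVg.
  move=> x; have : C (fsval x).2 (fsval x).1 = 0 by rewrite C0.
  rewrite groupRing_sumE (bigD1 x)//= groupRing_mulrzE /= eqxx.
  rewrite big1 ?addr0 => [|y /andP[/eqP yx2 yx]]; first by rewrite intz.
  rewrite groupRing_mulrzE /=; case: eqP => [yx1|_]; last by rewrite mul0rz.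
  case/eqP: yx; apply: val_inj => /=.
  by rewrite [fsval y]surjective_pairing [fsval x]surjective_pairing yx1 yx2.
pose u0 : F := FSetSub (fset1U1 (1%g, Ordinal p0) F0).
pose shift (x : F) : H * 'I_q :=
  (((fsval x).1^-1 * (fsval (f x)).1)%g, (fsval (f x)).2).
exists (fun x => shift (insubd u0 x)); split=> [x|x y xF0 yF0].
  exact: inL (fM _).
have F0F z : z \in F0 -> fsval (insubd u0 z) = z.
  by move=> zF0; rewrite [LHS]insubdK// inE zF0 orbT.
rewrite /matched /= -{1}(F0F _ xF0) -{1}(F0F _ yF0) !mulKVg -!surjective_pairing.
by move=> /val_inj/f_inj xy; rewrite -(F0F _ xF0) -(F0F _ yF0) xy.
Qed.

(** * Integral group rings without zero divisors *)

Lemma analytic_zero_divisor_domain (R : realType) (G : groupType) :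
  analytic_zero_divisor_conjecture R G -> domain (groupRing int G).
Proof.
move=> azd a b ab0; have [->|a0] := eqVneq a 0; first by left.
have [->|b0] := eqVneq b 0; first by right.
have fa' : (fun g => (a g)%:~R : R[i]) \in finsupp_pred R[i] G.
  apply/asboolP; apply: (sub_finite_set _ (groupRingP a)) => g.
  by rewrite /finsupp/= intr_eq0.
pose a' := GroupRing fa'; pose b' (g : G) : R[i] := (b g)%:~R.
exfalso; apply: (azd a' b').
- apply: contra_neq a0 => a'0; apply: val_inj; apply/funext => g /=.
  by apply/eqP; rewrite -(intr_eq0 R[i]) -[_%:~R]/(a' g) a'0.
- rewrite /square_summable (esumID (finsupp b)) ?setTI; last first.
    by move=> g _; rewrite lee_fin addr_ge0// sqr_ge0.
  rewrite [X in (_ + X)%E]esum1 ?adde0 => [|g nbg].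
    rewrite esum_fset ?fsbig_finite ?sumEFin ?ltry//; try exact: groupRingP.
    by move=> g _; rewrite lee_fin addr_ge0// sqr_ge0.
  by rewrite /b' (notin_finsupp nbg) /= expr0n addr0.
- move=> b'0; case/eqP: b0; apply: val_inj; apply/funext => g /=.
  by apply/eqP; rewrite -(intr_eq0 R[i]) -[_%:~R]/(b' g) b'0.
apply/funext => g; have fb := groupRingP b.
have b0' h : ~ finsupp b h -> b' h = 0.
  by move=> nb; rewrite /b' (notin_finsupp nb).
rewrite (convolutionE _ _ fb b0').
transitivity ((convolution a b g)%:~R : R[i]).
  rewrite (convolutionE _ _ fb (@notin_finsupp _ _ (group_coef b))) rmorph_sum.
  by apply: eq_bigr => h _; rewrite /= intrM.
by rewrite -[convolution a b g]/((a * b) g) ab0.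
Qed.

(** * Double cosets of a commensurated subgroup *)

Section Cosets.
Variables (G : groupType) (H : groupClosed G).

(** The choice depends only on the right coset H g, so that removing duplicates
    among representatives leaves one for each coset. *)
Definition coset_repr (g : G) : G := choose (fun x => (x * g^-1)%g \in H) g.

Lemma coset_reprP g : (coset_repr g * g^-1)%g \in H.
Proof.
by apply: (@chooseP _ (fun x => (x * g^-1)%g \in H)); rewrite mulgV gpred1.
Qed.

Lemma coset_repr_eq g k : (g * k^-1)%g \in H -> coset_repr g = coset_repr k.
Proof.
move=> gk; rewrite /coset_repr.
have eqP : (fun x => (x * g^-1)%g \in H) =1 (fun x => (x * k^-1)%g \in H).
  move=> x; apply/idP/idP => xH.
    by have := gpredM _ _ xH gk; rewrite mulgA mulgVK.
  by have := gpredF xH gk; rewrite invgM invgK mulgA mulgVK.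
rewrite (eq_choose eqP); apply: choose_id; last by rewrite mulgV gpred1.
exact: gk.
Qed.

(** H g H is a finite union of right cosets of H: for k in H with g k g^-1 in H,
    the right coset of g h is that of g k h, so there are no more right
    cosets than cosets of the finite index subgroup of these k in H. *)
Lemma commensurates_double_coset (g : G) : commensurates [set` H] ->
  exists Z : seq G, (forall z, z \in Z -> exists2 t, t \in H & z = (g * t)%g) /\
    forall h, h \in H -> exists2 z, z \in Z & (g * h * z^-1)%g \in H.
Proof.
move=> /(_ g)[/finite_seqP[s sP] _].
pose K := conjugate [set` H] g `&` [set` H].
pose t (C : set G) := xget 1%g [set t | t \in H /\ C = [set (t * k)%g | k in K]].
have tP C : C \in s -> t C \in H /\ C = [set (t C * k)%g | k in K].
  move=> Cs; have : [set` s] C by [].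
  rewrite -sP => -[h hH hC]; rewrite /t.
  by case: xgetP => [x -> //|/(_ h)]; case.
exists [seq (g * (t C)^-1)%g | C <- s]; split=> [z /mapP[C Cs ->]|h hH].
  by exists (t C)^-1%g => //; rewrite gpredV; case: (tP C Cs).
pose C := [set (h^-1 * k)%g | k in K].
have Cs : C \in s.
  suff : [set` s] C by [].
  by rewrite -sP; exists h^-1%g => //=; rewrite gpredV.
have Ch : C h^-1%g.
  exists 1%g; last by rewrite mulg1.
  split; last exact: gpred1.
  by exists 1%g; [exact: gpred1 | rewrite conj1g].
clearbody C; exists (g * (t C)^-1)%g; first by apply: map_f.
have [tH CE] := tP C Cs; move: Ch; rewrite {1}CE => -[k [[x xH xk] kH] tk].
have -> : h = (k^-1 * (t C)^-1)%g by rewrite -invgM tk invgK.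
rewrite -xk /= in xH *.
rewrite conjgE !invgM !invgK !mulgA mulgV mul1g.
by rewrite mulgVK mulgK gpredV.
Qed.

(** A finite transversal Y of right cosets whose union contains l and is stable
    under right multiplication by H. *)
Lemma double_coset_transversal (l : seq G) : commensurates [set` H] ->
  exists Y : seq G,
    [/\ forall x, x \in l -> exists2 y, y \in Y & (x * y^-1)%g \in H,
        forall y h, y \in Y -> h \in H ->
          exists2 y', y' \in Y & (y * h * y'^-1)%g \in H,
        {in Y &, forall y y', (y * y'^-1)%g \in H -> y = y'} & uniq Y].
Proof.
move=> commH; have /choice[Z ZP] g := commensurates_double_coset g commH.
pose Y := undup [seq coset_repr z | z <- flatten [seq Z g | g <- l]].
have Yrepr z g : g \in l -> z \in Z g -> coset_repr z \in Y.
  move=> gl zg; rewrite mem_undup; apply: map_f; apply/flattenP.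
  by exists (Z g) => //; exact: map_f.
have repr_near x z : (x * z^-1)%g \in H -> (x * (coset_repr z)^-1)%g \in H.
  move=> xz; have := gpredF xz (coset_reprP z).
  by rewrite invgM invgK mulgA mulgVK.
have YP y : y \in Y ->
    exists2 g, g \in l & exists2 z, z \in Z g & y = coset_repr z.
  rewrite mem_undup => /mapP[z /flattenP[_ /mapP[g gl ->] zg] ->].
  by exists g => //; exists z.
exists Y; split; last exact: undup_uniq.
- move=> x xl; have [_ /(_ 1%g gpred1)[z zx]] := ZP x.
  rewrite mulg1 => /repr_near xz.
  by exists (coset_repr z) => //; exact: Yrepr zx.
- move=> _ h /YP[g gl [z zg ->]] hH; have [/(_ z zg)[t tH zE] ZH] := ZP g.
  have [z' z'g z'H] := ZH (t * h)%g (gpredM _ _ tH hH).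
  exists (coset_repr z'); first exact: Yrepr z'g.
  apply: repr_near; move: z'H; rewrite mulgA -zE => z'H.
  by have := gpredM _ _ (coset_reprP z) z'H; rewrite !mulgA mulgVK.
- move=> _ _ /YP[g gl [z zg ->]] /YP[g' gl' [z' zg' ->]] zz'.
  apply: coset_repr_eq.
  have -> : (z * z'^-1 = (coset_repr z * z^-1)^-1 *
      (coset_repr z * (coset_repr z')^-1 * (coset_repr z' * z'^-1)))%g.
    by rewrite invgM invgK !mulgA !mulgVK.
  apply: gpredM; first by rewrite gpredV; exact: coset_reprP.
  by apply: gpredM => //; exact: coset_reprP.
Qed.

End Cosets.

(** * The Ore condition *)

Lemma groupRing_decomposition (G : groupType) (c : groupRing int G) :
  c = \sum_(k <- fset_set (finsupp c)) group_elt int k *~ c k.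
Proof.
apply: val_inj; apply/funext => g; rewrite -[RHS]/(group_coef _ g) groupRing_sumE.
have [gc|gc] := boolP (g \in fset_set (finsupp c)).
  rewrite (bigD1_seq g gc (fset_uniq _)) groupRing_mulrzE /= eqxx intz.
  rewrite big1 ?addr0// => k kg.
  by rewrite groupRing_mulrzE /= eq_sym (negPf kg) mul0rz.
rewrite big1_seq => [|k /andP[_ kc]].
  by apply/eqP; move: gc; rewrite in_finsupp negbK.
rewrite groupRing_mulrzE /=; case: eqP => [e|_]; last by rewrite mul0rz.
by move: gc; rewrite e kc.
Qed.

Section Ore.
Variables (R : realType) (G : groupType) (H : groupClosed G).
Local Notation ZG := (groupRing int G).
Local Notation HT := (subgroup_type H).
Hypotheses (domG : domain ZG) (amenH : amenable R HT).
Hypothesis commH : commensurates [set` H].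

Definition subgroup_denominators (s : ZG) : Prop :=
  s != 0 /\ forall g, s g != 0 -> g \in H.

(** The inclusion of Z[H] in Z[G]. *)
Definition extend (c : groupRing int HT) : ZG :=
  \sum_(h <- fset_set (finsupp c)) group_elt int (\val h) *~ c h.

Lemma extendM c (b : ZG) g :
  (extend c * b) g =
  \sum_(h <- fset_set (finsupp c)) c h * b ((\val h)^-1 * g)%g.
Proof.
rewrite mulr_suml groupRing_sumE; apply: eq_bigr => h _.
by rewrite mulrzAl groupRing_mulrzE group_eltM -mulrzr intz mulrC.
Qed.

Lemma extendE c (h : HT) : extend c (\val h) = c h.
Proof.
rewrite -[extend c]mulr1 extendM.
have [hc|hc] := boolP (h \in fset_set (finsupp c)).
  rewrite (bigD1_seq h hc (fset_uniq _)) [(_^-1 * _)%g]mulVg /= eqxx mulr1.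
  rewrite big1 ?addr0// => k kh.
  case: eqP => [e|_]; last by rewrite mulr0.
  by case/eqP: kh; apply: val_inj; rewrite -[LHS]mulg1 -e mulKVg.
rewrite big_seq big1 => [|k kc].
  by move: hc; rewrite in_finsupp negbK => /eqP.
rewrite /=; case: eqP => [e|_]; last by rewrite mulr0.
suff kh : k = h by move: hc; rewrite -kh kc.
by apply: val_inj; rewrite -[LHS]mulg1 -e mulKVg.
Qed.

Lemma extend_supp c g : extend c g != 0 -> g \in H.
Proof.
rewrite -[extend c]mulr1 extendM => nz.
have [k _] : exists2 k : HT, True & ((\val k)^-1 * g)%g == 1%g.
  apply: contrapT => nk; case/eqP: nz; apply: big1 => k _ /=.
  case: eqP => [e|_]; last by rewrite mulr0.
  by case: nk; exists k => //; apply/eqP.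
move=> /eqP e; rewrite -[g](mulKVg (\val k)) e mulg1; exact: valP.
Qed.

(** The coefficient of y when b is written in a basis of Z[G] as a left
    Z[H]-module that contains y and represents the right cosets of H. *)
Let coset_coordinate_subproof (b : ZG) (y : G) :
  (fun h : HT => b (\val h * y)%g) \in finsupp_pred int HT.
Proof.
apply/asboolP; pose e (g : G) : HT := insubd 1%g (g * y^-1)%g.
apply: (@sub_finite_set _ _ [set e g | g in finsupp b]); last first.
  by apply: finite_image; exact: groupRingP.
move=> h bh; exists (\val h * y)%g => //; apply: val_inj.
by rewrite /e mulgK val_insubd [_ \in _]valP.
Qed.
Definition coset_coordinate b y := GroupRing (coset_coordinate_subproof b y).

Lemma coset_coordinateM c b y :
  coset_coordinate (extend c * b) y = c * coset_coordinate b y.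
Proof.
apply: val_inj; apply/funext => h.
rewrite -[LHS]/((extend c * b) (\val h * y)%g) extendM.
rewrite -[RHS]/((c * coset_coordinate b y) h).
transitivity (((\sum_(k <- fset_set (finsupp c)) group_elt int k *~ c k) *
  coset_coordinate b y) h); last by rewrite -groupRing_decomposition.
rewrite mulr_suml groupRing_sumE.
apply: eq_bigr => k _.
by rewrite mulrzAl groupRing_mulrzE group_eltM -mulrzr intz mulrC /= mulgA.
Qed.

Lemma coset_coordinate_sum (I : finType) (c : I -> groupRing int HT)
    (b : I -> ZG) y :
  coset_coordinate (\sum_i extend (c i) * b i) y =
  \sum_i c i * coset_coordinate (b i) y.
Proof.
apply: val_inj; apply/funext => h.
rewrite -[RHS]/(group_coef _ h) groupRing_sumE.
rewrite -[LHS]/((\sum_i extend (c i) * b i) (\val h * y)%g) groupRing_sumE.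
by apply: eq_bigr => i _; rewrite -coset_coordinateM.
Qed.

Lemma extend_eq0 c : extend c = 0 -> c = 0.
Proof.
by move=> c0; apply: val_inj; apply/funext => h; rewrite /= -extendE c0.
Qed.

(** All the elements of row lie in the free left Z[H]-module with basis Y, of
    rank size Y, and there is one more of them: they satisfy a relation
    c_0 r + sum of c_j y_j s = 0. If c_0 were 0, then cancelling s would give a
    relation between the basis elements y_j. *)
Lemma subgroup_denominators_ore (r s : ZG) : subgroup_denominators s ->
  exists r' s', subgroup_denominators s' /\ s' * r = r' * s.
Proof.
move=> [s0 sH].
have [Y [rY YH Yinj Yuniq]] :=
  double_coset_transversal (fset_set (finsupp r)) commH.
pose y (j : 'I_(size Y)) := tnth (in_tuple Y) j.
have yY j : y j \in Y by exact: mem_tnth.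
pose row (i : 'I_(size Y).+1) : ZG :=
  if unlift ord0 i is Some k then group_elt int (y k) * s else r.
pose near (b : ZG) :=
  forall g, b g != 0 -> exists2 z, z \in Y & (g * z^-1)%g \in H.
have row_near i : near (row i).
  move=> g; rewrite /row; case: unliftP => [k _|_]; last first.
    by rewrite -in_finsupp; exact: rY.
  rewrite group_eltM => /sH/(YH _ _ (yY k))[z zY zH]; exists z => //.
  by rewrite mulKVg in zH.
have [c [[i0 ci0] cE]] := strong_rank_condition
  (fun i j => coset_coordinate (row i) (y j)) amenH (leqnn (size Y).+1).
pose B := \sum_i extend (c i) * row i.
have B0 : B = 0.
  apply: val_inj; apply/funext => g; apply/eqP; apply: contrapT => /negP Bg.
  have [i Big] : exists i, (extend (c i) * row i) g != 0.
    apply: contrapT => nB; case/eqP: Bg.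
    rewrite -[LHS]/(B g) groupRing_sumE big1// => i _.
    by apply/eqP; apply: contrapT => /negP ?; apply: nB; exists i.
  have [h hH [k kn gE]] :
      exists2 h, h \in H & exists2 k, row i k != 0 & g = (h * k)%g.
    have [h /extend_supp hH [k kn gE]] :=
      @finsupp_convolution _ _ (extend (c i)) (row i) g Big.
    by exists h => //; exists k.
  have [z zY zH] := row_near i k kn.
  have [j yj] : exists j, y j = z.
    by have /tnthP[j ->] : z \in in_tuple Y by []; exists j.
  have gz : (g * z^-1)%g \in H by rewrite gE -mulgA gpredM.
  pose u : HT := Sub (g * z^-1)%g gz.
  have : coset_coordinate B (y j) u = 0.
    by rewrite /B coset_coordinate_sum cE.
  by move=> /= /eqP; rewrite yj mulgVK (negPf Bg).
move: B0; rewrite /B big_ord_recl {1}/row unlift_none /= => /eqP.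
rewrite addr_eq0 => /eqP sr.
pose r' := \sum_(j < size Y) extend (c (lift ord0 j)) * group_elt int (y j).
have rE : extend (c ord0) * r = - r' * s.
  rewrite sr mulNr mulr_suml; congr (- _); apply: eq_bigr => j _.
  by rewrite /row liftK mulrA.
have [c0|c0] := eqVneq (c ord0) 0; last first.
  exists (- r'), (extend (c ord0)); split=> //; split; last exact: extend_supp.
  by apply: contra_neq c0 => /extend_eq0.
have r'0 : r' = 0.
  have e0 : extend 0 = 0.
    rewrite /extend (_ : fset_set _ = fset0) ?big_nil//.
    apply/eqP; rewrite -fsubset0; apply/fsubsetP => h.
    by rewrite in_finsupp eqxx.
  have r's0 : r' * s = 0.
    by apply: oppr_inj; rewrite -mulNr -rE c0 e0 mul0r oppr0.
  by have [//|s0'] := domG r's0; move: s0; rewrite s0' eqxx.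
have y_inj j k : (y k * (y j)^-1)%g \in H -> k = j.
  move=> /(Yinj _ _ (yY k) (yY j))/eqP; rewrite /y !(tnth_nth 1%g) nth_uniq//.
  by move=> /eqP/val_inj.
case/eqP: ci0; case: (unliftP ord0 i0) => [j ->|->//].
transitivity (coset_coordinate r' (y j)); last by rewrite r'0; apply: val_inj.
rewrite coset_coordinate_sum (bigD1 j)//= big1 ?addr0 => [|k kj].
  rewrite [coset_coordinate _ _](_ : _ = 1) ?mulr1//.
  apply: val_inj; apply/funext => h /=; congr (nat_of_bool _)%:R.
  by rewrite -[RHS](inj_eq val_inj) /= -{2}[y j]mul1g (inj_eq (mulIg _)).
rewrite [coset_coordinate _ _](_ : _ = 0) ?mulr0//.
apply: val_inj; apply/funext => h /=; case: eqP => // hy.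
case/eqP: kj; apply: y_inj; rewrite -hy mulgK; exact: valP.
Qed.
Lemma subgroup_left_denominator_set :
  left_denominator_set subgroup_denominators.
Proof.
split.
- split=> [|g /=]; first exact: oner_neq0.
  by have [->|_] := eqVneq g 1%g; [rewrite gpred1 | rewrite eqxx].
- move=> s t [s0 sH] [t0 tH]; split=> [|g st0].
    by apply/eqP => /domG[/eqP|/eqP]; [rewrite (negPf s0) | rewrite (negPf t0)].
  have [x /sH xH [y /tH yH <-]] := @finsupp_convolution _ _ s t g st0.
  exact: gpredM.
- by move=> s [].
- exact: subgroup_denominators_ore.
Qed.

End Ore.

(** * Finiteness of groups that commensurate an amenable subgroup *)

(** For x in H other than 1, the coefficients of x - 1 add up to 0. *)
Lemma trivial_module_torsion (G : groupType) (H : groupClosed G) :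
    (exists2 x : G, x \in H & x != 1%g) ->
  exists2 s : groupRing int G, subgroup_denominators H s &
    forall z : trivial_module G, s *: z = 0.
Proof.
move=> [x xH x1]; exists (group_elt int x - 1).
  split=> [|g]; last first.
    have -> : (group_elt int x - 1 : groupRing int G) g =
      (g == x)%:R - (g == 1%g)%:R by [].
    have [->//|_] := eqVneq g x; have [->|_] := eqVneq g 1%g.
      by rewrite gpred1.
    by rewrite subrr eqxx.
  apply/eqP => /(congr1 (fun a : groupRing int G => a x)).
  have -> : (group_elt int x - 1 : groupRing int G) x =
    (x == x)%:R - (x == 1%g)%:R by [].
  by rewrite eqxx (negPf x1).
move=> z; rewrite scalerBl scale1r.
rewrite -[X in X - _]/(coef_sum (group_elt int x) * (z : int)).
rewrite /coef_sum (fsum_delta (j := x)) /= => [|g /negPf -> //].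
by rewrite eqxx mul1r subrr.
Qed.

Lemma trivial_module_finitely_generated (G : groupType) :
  finitely_generated (trivial_module G : lmodType (groupRing int G)).
Proof.
exists 1, (fun=> (1 : int) : trivial_module G) => z.
exists (fun=> 1 *~ (z : int)).
rewrite big_ord1 -scalerMzl scale1r; exact/esym/intz.
Qed.

Theorem corollary3 (R : realType) (G : groupType) (n : nat) :
  analytic_zero_divisor_conjecture R G ->
  (exists H : groupClosed G,
     [/\ (exists2 x : G, x \in H & x != 1%g),
         amenable R (subgroup_type H) &
         commensurates [set` H]%classic]) ->
  cohomological_dimension G n ->
  type_FPn G (n%:Z - 1) ->
  type_FP G.
Proof.
move=> azd [H [Hnt amenH commH]] [[P lenP] _] [Q fgQ].
have domG := analytic_zero_divisor_domain azd.
have fgQ' d : (d < n)%N -> finitely_generated (Q d).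
  by move=> dn; apply: fgQ; rewrite lerBrDl -intS lez_nat.
have projK := @syzygy_projective _ _ Q _ _ lenP.
apply: (syzygy_FP projK) => //.
have denH := subgroup_left_denominator_set domG amenH commH.
apply: (syzygy_finitely_generated domG denH (trivial_module_torsion Hnt)) => //.
(* degree n of the augmented complex is the trivial module itself if n = 0 *)
case: n fgQ' {lenP fgQ projK} => [_|n fgQ]; last exact: fgQ.
exact: trivial_module_finitely_generated.
Qed.
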